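(* Let $n\ge 2$, let $k=k(t,n)$ be one of the digital adjacencies of $\mathbb{Z}^n$, and let $SC_k^{n,l}=(x_i)_{i\in\{0,\dots,l-1\}}$ be a simple closed $k$-curve with $l\ge4$ elements in $\mathbb{Z}^n$. With the operations $x_i\ast_1 x_j=x_{i+j\,(\mathrm{mod}\,l)}$ and $x_i\star x_j=x_{i\cdot j\,(\mathrm{mod}\,l)}$, $(SC_k^{n,l},\ast_1,\star)$ is a commutative ring with unity $x_1$.
   Context: For $1\le t\le n$, two distinct points of $\mathbb{Z}^n$ are $k(t,n)$-adjacent if at most $t$ of their coordinates differ by $\pm1$ and all the other coordinates coincide; the adjacency is named by the number $k=k(t,n)=\sum_{i=1}^{t}2^i\binom{n}{i}$. A simple closed $k$-curve with $l$ elements in $\mathbb{Z}^n$ ($l\ge 4$, $n\ge 2$), denoted $SC_k^{n,l}$, is a sequence $(x_i)_{i\in\{0,\dots,l-1\}}$ of $l$ distinct points of $\mathbb{Z}^n$ such that $x_i$ and $x_j$ are $k$-adjacent if and only if $i-j\equiv\pm1\pmod l$. Indices mod $l$ are reduced to $\{0,\dots,l-1\}$. *)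

(* Defs.v *)
From HB Require Import structures.
From mathcomp Require Import all_boot all_order all_algebra.

Set Implicit Arguments.
Unset Strict Implicit.
Unset Printing Implicit Defensive.

Import Order.TTheory GRing.Theory Num.Theory.
Local Open Scope ring_scope.

(* Points of Z^n are integer row vectors 'rV[int]_n. *)

Definition adj_number (t n : nat) : nat :=
  (\sum_(1 <= i < t.+1) 2 ^ i * 'C(n, i))%N.

Definition differing (n : nat) (p q : 'rV[int]_n) : {set 'I_n} :=
  [set i | p 0 i != q 0 i].

Definition t_adjacent (n t : nat) (p q : 'rV[int]_n) : bool :=
  [&& p != q,
      [forall i in differing p q, (p 0 i - q 0 i == 1) || (p 0 i - q 0 i == -1)] &
      (#|differing p q| <= t)%N].

(* The adjacency named by the number k. By [k_adjacentE], the t with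
   k = adj_number t n and 1 <= t <= n is unique; no two points are k-adjacent
   when k is not one of the numbers k(1,n), ..., k(n,n). *)
Definition k_adjacent (n k : nat) (p q : 'rV[int]_n) : bool :=
  [exists t : 'I_n.+1,
    [&& (0 < t)%N, k == adj_number t n & t_adjacent t p q]].

Lemma adj_number_lt n s t :
  (s < t)%N -> (t <= n)%N -> (adj_number s n < adj_number t n)%N.
Proof.
move=> lt_st le_tn; rewrite /adj_number.
rewrite [X in (_ < X)%N](@big_cat_nat _ _ _ s.+1); [|by []|exact: leqW].
rewrite -[X in (X < _)%N]addn0 ltn_add2l big_nat_recr //=.
by rewrite addn_gt0 muln_gt0 expn_gt0 bin_gt0 le_tn orbT.
Qed.

Lemma k_adjacentE n t (p q : 'rV[int]_n) : (1 <= t <= n)%N ->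
  k_adjacent (adj_number t n) p q = t_adjacent t p q.
Proof.
move=> /andP[t_gt0 le_tn]; apply/existsP/idP => [[s /and3P[_ /eqP eq_st]]|adj].
  suff -> : t = s by [].
  case: (ltngtP t s) => // [lt_ts|lt_st].
    have /(adj_number_lt lt_ts) : (s <= n)%N by rewrite -ltnS.
    by rewrite eq_st ltnn.
  by have := adj_number_lt lt_st le_tn; rewrite eq_st ltnn.
by exists (Ordinal (n := n.+1) le_tn); rewrite /= t_gt0 eqxx.
Qed.

Record simple_closed_curve (n k l : nat) := SimpleClosedCurve {
  sc_seq :> 'I_l -> 'rV[int]_n;
  sc_dim : (2 <= n)%N;
  sc_size : (4 <= l)%N;
  sc_inj : injective sc_seq;
  sc_adj : forall i j : 'I_l,
    k_adjacent k (sc_seq i) (sc_seq j) <->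
    (i%:Z - j%:Z = 1 %[mod l%:Z])%Z \/ (i%:Z - j%:Z = -1 %[mod l%:Z])%Z }.

Section CurveOperations.

Variables (n k l : nat) (C : simple_closed_curve n k l).

Definition sc_point : Type := {p : 'rV[int]_n | p \in codom C}.

Lemma sc_size_gt0 : (0 < l)%N.
Proof. exact: leq_trans (sc_size C). Qed.

(* The point x_(m mod l) of the curve, for any natural number m. *)
Definition sc_nth (m : nat) : sc_point :=
  exist _ (C (Ordinal (ltn_pmod m sc_size_gt0))) (codom_f C _).

Definition sc_index (p : sc_point) : 'I_l := iinv (valP p).

Definition sc_add (p q : sc_point) : sc_point :=
  sc_nth (sc_index p + sc_index q).

Definition sc_mul (p q : sc_point) : sc_point :=
  sc_nth (sc_index p * sc_index q).

Lemma sc_nthK (m : nat) : sc_index (sc_nth m) = (m %% l)%N :> nat.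
Proof.
by rewrite /sc_index; set e := valP _; have /sc_inj -> := f_iinv e.
Qed.

Lemma sc_indexK (p : sc_point) : sc_nth (sc_index p) = p.
Proof.
apply: val_inj => /=; rewrite -[RHS](f_iinv (valP p)).
by congr (C _); apply: val_inj; rewrite /= modn_small.
Qed.

Lemma sc_addE (i j : nat) : sc_add (sc_nth i) (sc_nth j) = sc_nth (i + j).
Proof.
apply: val_inj; congr (C _); apply: val_inj.
by rewrite /= !sc_nthK modnDm.
Qed.

Lemma sc_mulE (i j : nat) : sc_mul (sc_nth i) (sc_nth j) = sc_nth (i * j).
Proof.
apply: val_inj; congr (C _); apply: val_inj.
by rewrite /= !sc_nthK modnMm.
Qed.

End CurveOperations.

(* (T, add, mul) is a commutative ring with unity one: the type T itself
   carries a commutative ring structure with these operations and this unit. *)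
Definition is_comring_with_unity (T : Type) (add mul : T -> T -> T) (one : T) :
    Prop :=
  exists c : GRing.ComNzRing.axioms_ T,
    let R : comNzRingType := GRing.ComNzRing.Pack c in
    [/\ forall a b : R, a + b = add a b,
        forall a b : R, a * b = mul a b
      & (1 : R) = one].

(* Main.v *)
Require Import Defs.
From HB Require Import structures.
From mathcomp Require Import all_boot all_order all_algebra.

(** The map [m |-> x_(m mod l)] from the natural numbers onto the curve is
    surjective and carries addition and multiplication to the two operations of
    the curve, so the semiring identities of the natural numbers descend; the
    opposite of [x_i] is [x_(l - i)], and [x_0 <> x_1] because [l >= 4]. *)

Set Implicit Arguments.
Unset Strict Implicit.
Unset Printing Implicit Defensive.

Section CurveRing.

Variables (n k l : nat) (C : simple_closed_curve n k l).
Implicit Types p q r : sc_point C.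

(** At index 0 the difference is [l] itself, out of range, but [sc_nth] reduces it to 0. *)
Definition sc_opp p : sc_point C := sc_nth C (l - sc_index p).

Lemma eq_sc_nth i j : i = j %[mod l] -> sc_nth C i = sc_nth C j.
Proof. by move=> eq_ij; apply: val_inj; congr (C _); apply: val_inj. Qed.

Lemma sc_addA : associative (@sc_add n k l C).
Proof.
move=> p q r; rewrite -(sc_indexK p) -(sc_indexK q) -(sc_indexK r).
by rewrite !sc_addE addnA.
Qed.

Lemma sc_addC : commutative (@sc_add n k l C).
Proof. by move=> p q; rewrite /sc_add addnC. Qed.

Lemma sc_add0 : left_id (sc_nth C 0) (@sc_add n k l C).
Proof. by move=> p; rewrite -(sc_indexK p) sc_addE. Qed.

Lemma sc_addN : left_inverse (sc_nth C 0) sc_opp (@sc_add n k l C).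
Proof.
move=> p; rewrite -[X in sc_add _ X]sc_indexK /sc_opp sc_addE.
(* The truncated subtraction cancels since an index is below [l]; what remains is [l = 0] modulo
   [l]. *)
by rewrite subnK; [apply: eq_sc_nth; rewrite modnn mod0n | exact: ltnW].
Qed.

Lemma sc_mulA : associative (@sc_mul n k l C).
Proof.
move=> p q r; rewrite -(sc_indexK p) -(sc_indexK q) -(sc_indexK r).
by rewrite !sc_mulE mulnA.
Qed.

Lemma sc_mulC : commutative (@sc_mul n k l C).
Proof. by move=> p q; rewrite /sc_mul mulnC. Qed.

Lemma sc_mul1 : left_id (sc_nth C 1) (@sc_mul n k l C).
Proof. by move=> p; rewrite -(sc_indexK p) sc_mulE mul1n. Qed.

Lemma sc_mulDl : left_distributive (@sc_mul n k l C) (@sc_add n k l C).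
Proof.
move=> p q r; rewrite -(sc_indexK p) -(sc_indexK q) -(sc_indexK r).
by rewrite !(sc_addE, sc_mulE) mulnDl.
Qed.

(** A [comNzRingType] excludes the zero ring. *)
Lemma sc_nth1_neq0 : sc_nth C 1 != sc_nth C 0.
Proof.
apply/eqP => /(congr1 (fun p => sc_index p : nat)).
by rewrite !sc_nthK mod0n modn_small // (leq_trans _ (sc_size C)).
Qed.

(** The algebraic structures require a choice type; the curve takes it from the subtype that
    [sc_point] names. *)
HB.instance Definition _ :=
  Choice.copy (sc_point C) {p : 'rV[int]_n | p \in codom C}.
HB.instance Definition _ := GRing.isZmodule.Build (sc_point C)
  sc_addA sc_addC sc_add0 sc_addN.
HB.instance Definition _ := GRing.Zmodule_isComNzRing.Build (sc_point C)
  sc_mulA sc_mulC sc_mul1 sc_mulDl sc_nth1_neq0.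

End CurveRing.

Unset Implicit Arguments.

Theorem theorem4p4 (n t k l : nat) (hn : 2 <= n) (ht : 1 <= t <= n)
    (hk : k = adj_number t n) (hl : 4 <= l) (C : simple_closed_curve n k l) :
  is_comring_with_unity (sc_add (C := C)) (sc_mul (C := C)) (sc_nth C 1).
(* The inferred structure was built from these very operations and this unit, so the three equations
   hold by conversion. *)
Proof. by exists (GRing.ComNzRing.class (sc_point C)). Qed.
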